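(* There exists an absolute constant $C$ such that the following holds. Let $H$ be an $n$-vertex graph of maximum degree $\Delta\ge 2$ and chromatic number $\chi=\chi(H)\ge 3$. Then $ER(H)\le n^{C\Delta\chi n}$.
   Context: Edge-colorings of $K_N$ may use arbitrarily many colors. A copy of $H$ in $K_N$ (injective $\varphi:V(H)\to V(K_N)$) is canonically colored if it is monochromatic (all edges same color), rainbow (all edges distinct colors), or lexicographic: there is an ordering $v_1,\dots,v_n$ of $V(H)$ such that for each $i$ all edges $\varphi(v_i)\varphi(v_j)$ with $v_iv_j\in E(H)$, $j>i$, have the same color $c_i$, and these colors are distinct for different $v_i$. $ER(H)$ is the least $N$ such that every edge-coloring of $K_N$ contains a canonically colored copy of $H$. *)

(* Defs.v *)
From mathcomp Require Import all_boot.

Set Implicit Arguments.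
Unset Strict Implicit.
Unset Printing Implicit Defensive.

Record sgraph := SGraph {
  vertex :> finType;
  adj : rel vertex;
  adj_sym : symmetric adj;
  adj_irrefl : irreflexive adj }.

Definition edges (H : sgraph) : {set {set H}} :=
  [set [set p.1; p.2] | p : H * H & adj p.1 p.2].

Definition max_degree (H : sgraph) : nat :=
  \max_(x : H) #|[set y : H | adj x y]|.

Definition colorable (H : sgraph) (k : nat) : bool :=
  [exists f : {ffun H -> 'I_k}, forall x, forall y, adj x y ==> (f x != f y)].

Lemma colorable_card (H : sgraph) : exists k, colorable H k.
Proof.
exists #|H|; apply/existsP; exists [ffun x => enum_rank x].
apply/forallP => x; apply/forallP => y; apply/implyP => xy.
rewrite !ffunE (inj_eq enum_rank_inj).
by apply: contraTneq xy => ->; rewrite adj_irrefl.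
Qed.

Definition chromatic_number (H : sgraph) : nat := ex_minn (colorable_card H).

(* An edge-coloring of K_N: only the values on 2-element subsets of 'I_N are
   ever used. As K_N is finite, colors in nat amount to arbitrarily many
   colors. *)
Definition edge_coloring (N : nat) := {set 'I_N} -> nat.

Definition monochromatic (H : sgraph) (N : nat) (col : edge_coloring N)
    (phi : H -> 'I_N) : Prop :=
  {in edges H &, forall e f : {set H}, col (phi @: e) = col (phi @: f)}.

Definition rainbow (H : sgraph) (N : nat) (col : edge_coloring N)
    (phi : H -> 'I_N) : Prop :=
  {in edges H &, injective (fun e : {set H} => col (phi @: e))}.

(* The color c i is unconstrained by col when v i has no later neighbor;
   requiring c to be injective on all indices is then harmless, since nat
   always contains unused colors. *)
Definition lexicographic (H : sgraph) (N : nat) (col : edge_coloring N)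
    (phi : H -> 'I_N) : Prop :=
  exists (v : 'I_#|H| -> H) (c : 'I_#|H| -> nat),
    [/\ bijective v, injective c &
        forall i j : 'I_#|H|, i < j -> adj (v i) (v j) ->
          col [set phi (v i); phi (v j)] = c i].

Definition canonically_colored (H : sgraph) (N : nat) (col : edge_coloring N)
    (phi : H -> 'I_N) : Prop :=
  [\/ monochromatic col phi, rainbow col phi | lexicographic col phi].

Definition canonical_Ramsey (H : sgraph) (N : nat) : Prop :=
  forall col : edge_coloring N,
    exists2 phi : H -> 'I_N, injective phi & canonically_colored col phi.

(* is_ER H N means ER(H) = N. *)
Definition is_ER (H : sgraph) (N : nat) : Prop :=
  canonical_Ramsey H N /\ forall M, canonical_Ramsey H M -> N <= M.

(* Main.v *)
(* Put n = |H|, and let N be n^(16 D) to the power n (chi + 1), where D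
   is the maximum degree.  Keep a shrinking set S of vertices of K_N together with a
   list of vertices whose edges to all later ones and to S have distinct colours.
   With h = |S| / n^6, one of the following holds:
   (a) some v in S has at least h neighbours in S in a colour c not yet listed:
       append v to the list and replace S by this neighbourhood;
   (b) in a listed colour c, at least h vertices of S have at least h neighbours:
       dependent random choice with 2 D random vertices yields a subset of S in which
       any D vertices have n common c-neighbours in S; replace S by it;
   (c) otherwise a random map H -> S is a rainbow copy with positive probability.
   Steps (a) and (b) divide |S| by at most n^(16 D).  If (c) never occurs, then either
   the list reaches length n, giving a lexicographic copy, or step (b) is applied chi
   times to one colour, giving a monochromatic copy: embed the classes of a proper
   chi-colouring of H one after the other, from the innermost set outwards. *)
Require Import Defs.
From mathcomp Require Import all_boot zify.
From Stdlib Require Import Classical.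

Set Implicit Arguments.
Unset Strict Implicit.
Unset Printing Implicit Defensive.

(** * Double counting and dependent random choice *)

Lemma leq_expn2r m n e : m <= n -> m ^ e <= n ^ e.
Proof. by case: e => // e mn; rewrite leq_exp2r. Qed.

Lemma double_count (I J : finType) (A : {set I}) (B : {set J}) (R : I -> J -> bool) :
  \sum_(i in A) #|[set j in B | R i j]| = \sum_(j in B) #|[set i in A | R i j]|.
Proof.
transitivity (\sum_(i in A) \sum_(j in B | R i j) 1).
  by apply: eq_bigr => i _; rewrite -sum1_card; apply: eq_bigl => j; rewrite inE.
rewrite (exchange_big_dep (mem B)) /=; last by move=> i j _ /andP[].
apply: eq_bigr => j jB; rewrite -sum1_card; apply: eq_bigl => i.
by rewrite inE jB.
Qed.

Definition functions_into (I T : finType) (S : {set T}) :=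
  [set f : {ffun I -> T} | [forall i, f i \in S]].

Lemma card_functions_into (I T : finType) (S : {set T}) :
  #|functions_into I S| = #|S| ^ #|I|.
Proof.
rewrite -card_ffun_on; apply: eq_card => f; rewrite inE.
by apply/forallP/ffun_onP.
Qed.

Definition common_nbrs (T I : finType) (r : rel T) (S : {set T}) (g : I -> T) :=
  [set a in S | [forall i, r a (g i)]].

(** Average over all maps [f] from ['I_t] to [S], taking the common neighbourhood of [f] as [A]. The
    [h] heavy vertices alone make these sets have total size at least [h ^ t.+1]. A bad [D]-tuple
    has fewer than [n] common neighbours, so it lies in the common neighbourhood of at most [n ^ t]
    maps [f]. *)
Lemma dependent_random_choice (T : finType) (r : rel T) (S : {set T})
    (D n t h L : nat) :
  symmetric r ->
  h <= #|[set a in S | h <= #|[set b in S | r a b]|]| ->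
  L * #|S| ^ t + #|S| * (#|S| ^ D * n ^ t) < h ^ t.+1 ->
  exists A : {set T}, [/\ A \subset S, L <= #|A| &
    forall g : {ffun 'I_D -> T}, (forall i, g i \in A) ->
      n <= #|common_nbrs r S g|].
Proof.
move=> rsym heavy small.
pose bad := [set g in functions_into 'I_D S | #|common_nbrs r S g| < n].
pose badin (f : {ffun 'I_t -> T}) :=
  [set g in bad | [forall i, forall j, r (g i) (f j)]].
have sum_nbrs : h ^ t.+1 <= \sum_(f in functions_into 'I_t S) #|common_nbrs r S f|.
  rewrite double_count expnS.
  apply: leq_trans (_ : \sum_(a in [set a in S | h <= #|[set b in S | r a b]|]) h ^ t <= _).
    by rewrite sum_nat_const leq_mul2r heavy orbT.
  rewrite [leqRHS](big_setID [set a in S | h <= #|[set b in S | r a b]|]) /=.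
  apply: leq_trans (leq_addr _ _).
  rewrite (setIidPr _); last by apply/subsetP => a; rewrite inE => /andP[].
  apply: leq_sum => a; rewrite inE => /andP[aS ha].
  apply: leq_trans (_ : #|[set b in S | r a b]| ^ t <= _); first by rewrite leq_expn2r.
  rewrite -[X in _ ^ X]card_ord -card_functions_into; apply: subset_leq_card.
  apply/subsetP => f; rewrite !inE => /forallP fP.
  by apply/andP; split; apply/forallP => i; move: (fP i); rewrite inE => /andP[].
have sum_bad : \sum_(f in functions_into 'I_t S) #|badin f| <= #|S| ^ D * n ^ t.
  rewrite double_count.
  apply: leq_trans (_ : \sum_(g in bad) n ^ t <= _).
    apply: leq_sum => g; rewrite inE => /andP[_ gn].
    apply: leq_trans (_ : #|common_nbrs r S g| ^ t <= _); last first.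
      by rewrite leq_expn2r // ltnW.
    rewrite -[X in _ <= _ ^ X]card_ord -card_functions_into; apply: subset_leq_card.
    apply/subsetP => f; rewrite !inE => /andP[/forallP fS /forallP fP].
    apply/forallP => j; rewrite !inE fS; apply/forallP => i.
    by rewrite rsym; move/forallP: (fP i).
  rewrite sum_nat_const leq_mul // -[X in _ <= _ ^ X]card_ord -card_functions_into.
  by apply/subset_leq_card/subsetP => g; rewrite inE => /andP[].
case: (boolP [exists f in functions_into 'I_t S,
    (L <= #|common_nbrs r S f|) && (badin f == set0)]).
  case/existsP => f /and3P[_ Lf /eqP bad0].
  exists (common_nbrs r S f); split=> // [|g gA].
    by apply/subsetP => a; rewrite inE => /andP[].
  rewrite leqNgt; apply/negP => gn.
  suff: g \in badin f by rewrite bad0 inE.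
  rewrite !inE gn andbT; apply/andP; split; apply/forallP => i;
    by move: (gA i); rewrite inE => /andP[].
move/existsPn => none; exfalso.
move: small; rewrite ltnNge => /negP; apply.
apply: leq_trans sum_nbrs _.
(* A failing [f] has a common neighbourhood that is smaller than [L], or one that contains a bad
   tuple; a single bad tuple pays for all of [S]. *)
apply: leq_trans (_ : \sum_(f in functions_into 'I_t S) (L + #|S| * #|badin f|) <= _).
  apply: leq_sum => f fS; move: (none f); rewrite fS /= negb_and -ltnNge.
  case/orP => [/ltnW lt | ne0]; first exact: leq_trans lt (leq_addr _ _).
  apply: leq_trans (leq_addl _ _); apply: leq_trans (_ : #|S| * 1 <= _).
    by rewrite muln1 subset_leq_card //; apply/subsetP => a; rewrite inE => /andP[].
  by rewrite leq_mul2l card_gt0 ne0 orbT.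
rewrite big_split /= sum_nat_const card_functions_into card_ord mulnC leq_add2l.
by rewrite -big_distrr leq_mul2l sum_bad orbT.
Qed.

(** * Random maps that avoid small sets *)

Lemma card_dep_pairs (I J : finType) (X : {set I}) (Y : I -> {set J}) :
  #|[set p : I * J | (p.1 \in X) && (p.2 \in Y p.1)]| = \sum_(x in X) #|Y x|.
Proof.
rewrite -sum1_card.
transitivity (\sum_(x in X) \sum_(y in Y x) 1); last first.
  by apply: eq_bigr => x _; rewrite sum1_card.
by rewrite pair_big_dep; apply: eq_bigl => p; rewrite inE.
Qed.

(** A union bound: [B w f] does not depend on [f w], so a uniformly random [f] has [f w] in it with
    probability at most [b / #|S|]. *)
Lemma avoiding_function (I T : finType) (S : {set T})
    (B : I -> {ffun I -> T} -> {set T}) (b : nat) :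
  (forall w (f g : {ffun I -> T}), (forall x, x != w -> f x = g x) -> B w f = B w g) ->
  (forall w f, #|B w f| <= b) -> #|I| * b < #|S| ->
  exists f : {ffun I -> T}, forall w, f w \in S /\ f w \notin B w f.
Proof.
move=> Bindep Bcard bS.
pose X w := [set f in functions_into I S | f w \in B w f].
have cardX w : #|X w| * #|S| <= b * #|S| ^ #|I|.
  (* Instead of conditioning on the values of [f] away from [w], exchange [f w] with a free element
     of [S]. This involution turns a pair with [f w] in [B w f] into one whose second entry lies in
     [B w] of the first. *)
  pose swap (p : {ffun I -> T} * T) :=
    ([ffun x => if x == w then p.2 else p.1 x], p.1 w).
  have swapK : cancel swap swap.
    case=> f s; rewrite /swap /= ffunE eqxx; congr pair.
    by apply/ffunP => x; rewrite !ffunE; have [->|] := eqVneq x w.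
  rewrite -cardsX -(card_imset _ (can_inj swapK)).
  apply: leq_trans (_ : #|[set p | (p.1 \in functions_into I S) && (p.2 \in B w p.1)]| <= _).
    apply/subset_leq_card/subsetP => q /imsetP[[f s] /setXP[]].
    rewrite !inE => /andP[/forallP fS fB] sS -> /=; apply/andP; split.
      by apply/forallP => x; rewrite ffunE; case: ifP.
    rewrite (Bindep w _ f) // => x xw.
    by rewrite ffunE (negPf xw).
  rewrite card_dep_pairs mulnC -card_functions_into -sum_nat_const.
  exact: leq_sum.
case: (boolP [exists f in functions_into I S, [forall w, f w \notin B w f]]).
  case/existsP => f /andP[]; rewrite inE => /forallP fS /forallP fB.
  by exists f.
move/existsPn => none; exfalso.
have S0 : 0 < #|S| by apply: leq_ltn_trans bS.
have cover : #|S| ^ #|I| <= \sum_w #|X w|.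
  rewrite -card_functions_into.
  apply: leq_trans (_ : #|\bigcup_w X w| <= _); last first.
    by elim/big_ind2: _ => [|m A n A' mA nA'|//]; rewrite ?cards0 // cardsU;
      apply: leq_trans (leq_subr _ _) (leq_add _ _).
  apply/subset_leq_card/subsetP => f fS; apply/bigcupP.
  move: (none f); rewrite fS /= => /forallPn[w]; rewrite negbK => fw.
  by exists w => //; rewrite inE fS.
have : #|S| ^ #|I| * #|S| <= #|I| * b * #|S| ^ #|I|.
  apply: leq_trans (_ : (\sum_w #|X w|) * #|S| <= _); first by rewrite leq_mul2r cover orbT.
  by rewrite big_distrl /= -mulnA -sum_nat_const; apply: leq_sum.
by rewrite mulnC leq_pmul2r ?expn_gt0 ?S0 // leqNgt bS.
Qed.

(** * Embedding a graph along a chain of sets *)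

Lemma greedy_injection (I T : finType) (X : {set I}) (phi : I -> T) (B : I -> {set T}) :
  {in X &, injective phi} -> (forall x, x \notin X -> #|I| <= #|B x|) ->
  exists psi : I -> T, [/\ injective psi, {in X, psi =1 phi} &
    forall x, x \notin X -> psi x \in B x].
Proof.
have [m] := ubnP #|~: X|; elim: m X phi => // m IH X phi le_m inj_phi B_large.
have [X0 | [x]] := set_0Vmem (~: X).
  have XT x : x \in X by move/setP/(_ x): X0; rewrite !inE => /negbFE.
  by exists phi; split=> // [y z | y]; [apply: inj_phi | rewrite XT].
rewrite inE => xX.
have /subsetPn[t tB tphi] : ~~ (B x \subset phi @: X).
  apply/negP => /subset_leq_card leB.
  have := leq_trans (B_large x xX) (leq_trans leB (leq_imset_card _ _)).
  rewrite leqNgt => /negP; apply; rewrite -cardsT; apply: proper_card.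
  by rewrite properT; apply: contraNneq xX => ->; rewrite inE.
pose phi' y := if y == x then t else phi y.
have phi'E y : y \in X -> phi' y = phi y.
  by rewrite /phi' => yX; case: eqP => // yx; rewrite yx (negPf xX) in yX.
have phi'x : phi' x = t by rewrite /phi' eqxx.
have [|y z|y|psi [inj_psi psiE psiB]] := IH (x |: X) phi'.
- apply: leq_trans (le_m : _ <= m); apply: proper_card; apply/properP; split.
    by rewrite setCS subsetUr.
  by exists x; rewrite !inE ?eqxx.
- rewrite !in_setU1 => /orP[/eqP-> | yX] /orP[/eqP-> | zX] //.
  + rewrite phi'x (phi'E z) // => tE; case/negP: tphi.
    by rewrite tE imset_f.
  + rewrite phi'x (phi'E y) // => tE; case/negP: tphi.
    by rewrite -tE imset_f.
  + by rewrite !phi'E //; apply: inj_phi.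
- by rewrite in_setU1 negb_or => /andP[_]; apply: B_large.
exists psi; split=> // [y yX | y yX].
  by rewrite psiE ?in_setU1 ?yX ?orbT // phi'E.
have [-> | yx] := eqVneq y x; last by apply: psiB; rewrite in_setU1 negb_or yx.
by rewrite psiE ?setU11 // phi'x.
Qed.

(** A chain of [j] further sets around [S], each supplying common neighbours for the tuples of the
    set before it. Hiding the outer sets under existentials lets [S] shrink freely. *)
Fixpoint nested (T : finType) (r : rel T) (n D j : nat) (S : {set T}) : Prop :=
  if j is j'.+1 then
    exists S' : {set T}, [/\ S \subset S', nested r n D j' S' &
      forall g : {ffun 'I_D -> T}, (forall i, g i \in S) -> n <= #|common_nbrs r S' g|]
  else True.

Lemma nested_sub (T : finType) (r : rel T) (n D j : nat) (S A : {set T}) :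
  A \subset S -> nested r n D j S -> nested r n D j A.
Proof.
case: j => // j AS [S' [SS' nS' cS']]; exists S'; split=> //.
  exact: subset_trans AS SS'.
by move=> g gA; apply: cS' => i; apply: (subsetP AS).
Qed.

(** Classes are embedded in decreasing order of [f], moving one set outwards each time. A new vertex
    has at most [D] embedded neighbours, all with images in [S], hence [#|H|] candidates in [S']. *)
Lemma nested_embedding (H : sgraph) (T : finType) (r : rel T) (D : nat)
    (f : H -> nat) (j : nat) (S : {set T}) (phi : H -> T) :
  symmetric r -> max_degree H <= D -> (forall x y, adj x y -> f x != f y) ->
  S != set0 -> nested r #|H| D j S ->
  (forall x, j <= f x -> phi x \in S) ->
  {in [set x | j <= f x] &, injective phi} ->
  {in [set x | j <= f x] &, forall x y, adj x y -> r (phi x) (phi y)} ->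
  exists2 psi : H -> T, injective psi & forall x y, adj x y -> r (psi x) (psi y).
Proof.
move=> rsym degD proper_f.
elim: j S phi => [|j IH] S phi S0 nestS phiS phi_inj phi_r.
  by exists phi => [x y | x y]; [apply: phi_inj | apply: phi_r]; rewrite inE.
have [S' [SS' nestS' cS']] := nestS; have /set0Pn[s0 s0S] := S0.
pose X := [set x | j < f x].
pose nb x := [set y in X | adj x y].
(* The images of the embedded neighbours of [x], padded with [s0] to a tuple of length exactly
   [D]. *)
pose g x : {ffun 'I_D -> T} := [ffun i : 'I_D => nth s0 (map phi (enum (nb x))) i].
have gS x i : g x i \in S.
  rewrite ffunE; case: (ltnP i (size (map phi (enum (nb x))))) => [lt | ge]; last first.
    by rewrite nth_default.
  have /mapP[y] := mem_nth s0 lt; rewrite mem_enum !inE => /andP[jy _] ->.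
  exact: phiS.
have gP x y : y \in nb x -> exists i, g x i = phi y.
  move=> ynb; have lt : index y (enum (nb x)) < D.
    apply: leq_trans (_ : #|nb x| <= _); first by rewrite cardE index_mem mem_enum.
    apply: leq_trans degD; rewrite /max_degree.
    apply: leq_trans (leq_bigmax_cond (F := fun x : H => #|[set y : H | adj x y]|) x isT).
    by apply/subset_leq_card/subsetP => z; rewrite !inE => /andP[].
  exists (Ordinal lt); rewrite ffunE /= (nth_map y) ?index_mem ?mem_enum //.
  by rewrite nth_index ?mem_enum.
(* All vertices outside [X] receive an image here, but only the class [f x = j] keeps it; later
   rounds place the lower classes anew. *)
have [//|x xX|psi [psi_inj psiE psiB]] :=
    @greedy_injection _ _ X phi (fun x => common_nbrs r S' (g x)).
  exact: cS'.
have psiX x y : x \notin X -> y \in X -> adj x y -> r (psi x) (psi y).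
  move=> xX yX xy; have [|i gi] := gP x y; first by rewrite inE yX xy.
  have := psiB x xX; rewrite inE => /andP[_ /forallP/(_ i)].
  by rewrite gi (psiE y).
apply: (IH S' psi) => // [|x jx|x y _ _|x y].
- by apply/set0Pn; exists s0; apply: (subsetP SS').
- have [xX | xX] := boolP (x \in X); last first.
    by have := psiB x xX; rewrite inE => /andP[].
  by rewrite psiE //; apply: (subsetP SS'); apply: phiS; rewrite inE in xX.
- exact: psi_inj.
rewrite !inE => jx jy xy; have [xX | xX] := boolP (x \in X); last first.
  apply: psiX => //; move: xX (proper_f _ _ xy); rewrite !inE; lia.
have [yX | yX] := boolP (y \in X); last first.
  by rewrite rsym; apply: psiX; rewrite // adj_sym.
by rewrite !psiE //; apply: phi_r.
Qed.

(** * The three kinds of canonical copies *)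

Lemma card_bigcup_leq (T : finType) (I : Type) (s : seq I) (P : pred I)
    (A : I -> {set T}) (b : nat) :
  (forall i, P i -> #|A i| <= b) -> #|\bigcup_(i <- s | P i) A i| <= size s * b.
Proof.
move=> Ab; elim: s => [|i s IH]; first by rewrite big_nil cards0.
rewrite big_cons /= mulSn; case: ifP => [Pi | _]; last exact: leq_trans IH (leq_addl _ _).
by rewrite cardsU; apply: leq_trans (leq_subr _ _) (leq_add (Ab i Pi) IH).
Qed.

Lemma subset_bigcup_seq (T : finType) (I : eqType) (s : seq I) (P : pred I)
    (A : I -> {set T}) i :
  i \in s -> P i -> A i \subset \bigcup_(i <- s | P i) A i.
Proof. by move=> si Pi; rewrite (big_rem i) //= Pi subsetUl. Qed.

(** [col] also has values on singletons, so loops are excluded explicitly. *)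
Definition color_rel (N : nat) (col : edge_coloring N) (c : nat) : rel 'I_N :=
  fun x y => (x != y) && (col [set x; y] == c).

Lemma color_rel_sym N (col : edge_coloring N) c : symmetric (color_rel col c).
Proof. by move=> x y; rewrite /color_rel eq_sym setUC. Qed.

Definition color_nbrs (N : nat) (col : edge_coloring N) (c : nat) (S : {set 'I_N}) v :=
  [set w in S | color_rel col c v w].

Lemma edgesP (H : sgraph) (e : {set H}) :
  reflect (exists x y, adj x y /\ e = [set x; y]) (e \in edges H).
Proof.
apply: (iffP imsetP) => [[[x y]] | [x [y [xy ->]]]].
  by rewrite inE /= => xy ->; exists x, y.
by exists (x, y); rewrite ?inE.
Qed.

Lemma monochromatic_copy (H : sgraph) N (col : edge_coloring N) D j c (S : {set 'I_N})
    (f : H -> nat) :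
  max_degree H <= D -> (forall x y, adj x y -> f x != f y) -> (forall x, f x < j) ->
  S != set0 -> nested (color_rel col c) #|H| D j S ->
  exists2 phi : H -> 'I_N, injective phi & canonically_colored col phi.
Proof.
move=> degD proper_f fj S0 nestS; have /set0Pn[s0 _] := S0.
have fX x : (j <= f x) = false by rewrite leqNgt fj.
(* No class reaches [j], so nothing is embedded yet and a constant map can start the process. *)
have [x|x y|x y|phi inj_phi phiP] := @nested_embedding H _ _ D f j S (fun=> s0)
    (color_rel_sym col c) degD proper_f S0 nestS.
- by rewrite fX.
- by rewrite inE fX.
- by rewrite inE fX.
exists phi => //; apply: Or31 => e e' /edgesP[x [y [xy ->]]] /edgesP[z [t [zt ->]]].
rewrite !imsetU1 !imset_set1.
by have /andP[_ /eqP->] := phiP _ _ xy; have /andP[_ /eqP->] := phiP _ _ zt.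
Qed.

(** The first [#|H|] vertices of [L] span a lexicographically coloured complete graph, so any
    ordering of [H] will do. *)
Lemma lexicographic_copy (H : sgraph) N (col : edge_coloring N) (L : seq ('I_N * nat)) :
  0 < #|H| <= size L -> uniq (map snd L) ->
  pairwise (fun p q => color_rel col p.2 p.1 q.1) L ->
  exists2 phi : H -> 'I_N, injective phi & canonically_colored col phi.
Proof.
case: L => [|p0 L']; first by case/andP=> /leq_trans H0 /H0.
set L := p0 :: L' => /andP[_ HL] uniqL /(pairwiseP p0) pairL.
have ltL (i : 'I_#|H|) : i < size L by apply: leq_trans (ltn_ord i) HL.
have lex (i j : 'I_#|H|) : i < j ->
    color_rel col (nth p0 L i).2 (nth p0 L i).1 (nth p0 L j).1.
  by move=> ij; apply: pairL; rewrite ?inE.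
exists (fun x => (nth p0 L (enum_rank x)).1) => [x y xy|].
  apply: enum_rank_inj; apply: val_inj.
  by case: (ltngtP (enum_rank x) (enum_rank y)) => // /lex /andP[]; rewrite xy eqxx.
apply: Or33; exists enum_val, (fun i => (nth p0 L i).2); split.
- exact: enum_val_bij.
- move=> i j; rewrite -!(nth_map _ p0.2) // => /eqP.
  by rewrite nth_uniq ?size_map // => /eqP/val_inj.
by move=> i j ij _; rewrite !enum_valK; have /andP[_ /eqP] := lex i j ij.
Qed.

Lemma rainbow_copy (H : sgraph) N (col : edge_coloring N) (S : {set 'I_N}) (U : seq nat) h :
  size U <= #|H| -> 0 < h -> 0 < #|H| ->
  (forall v c, v \in S -> c \notin U -> #|color_nbrs col c S v| < h) ->
  (forall c, c \in U -> #|[set v in S | h <= #|color_nbrs col c S v|]| < h) ->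
  #|H| * (3 * #|H| ^ 3 * h) < #|S| ->
  exists2 phi : H -> 'I_N, injective phi & canonically_colored col phi.
Proof.
move=> UH h0 H0 light few small; set n := #|H| in UH H0 small *.
pose heavy := \bigcup_(c <- U | c \in U) [set v in S | h <= #|color_nbrs col c S v|].
have heavyP v c : v \in S -> v \notin heavy -> #|color_nbrs col c S v| < h.
  move=> vS vU; case: (boolP (c \in U)) => [cU | ]; last exact: light.
  rewrite ltnNge; apply: contra vU => hv; rewrite /heavy.
  by apply: (subsetP (subset_bigcup_seq _ cU cU)); rewrite inE vS.
have card_heavy : #|heavy| <= n * h.
  apply: leq_trans (_ : size U * h <= _); last by rewrite leq_mul2r UH orbT.
  by apply: card_bigcup_leq => c /few/ltnW.
(* If [phi w] avoids this set for every [w], then no two edges of [H] get the same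
   colour: one of them has an end [w] outside the other. *)
pose avoid w (phi : {ffun H -> 'I_N}) : {set 'I_N} :=
  heavy :|: \bigcup_(u <- enum H | u != w) [set phi u] :|:
  \bigcup_(p <- enum {: H * H * H} | [&& p.1.1 != w, p.1.2 != w & p.2 != w])
    (if (phi p.2 \in S) && (phi p.2 \notin heavy)
     then color_nbrs col (col [set phi p.1.1; phi p.1.2]) S (phi p.2) else set0).
(* The three parts of [avoid] have at most [n * h], [n] and [n ^ 3 * h] elements, each at most
   [n ^ 3 * h]. The test inside [avoid] makes the last bound hold for every map, even one that
   leaves [S] or meets [heavy]. *)
have [w phi psi eq_phi|w phi||phi phiP] := @avoiding_function H _ S avoid (3 * n ^ 3 * h).
- rewrite /avoid; congr (_ :|: _ :|: _).
    by apply: eq_bigr => u /eq_phi->.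
  by apply: eq_bigr => p /and3P[/eq_phi-> /eq_phi-> /eq_phi->].
- rewrite /avoid.
  have le1 : #|\bigcup_(u <- enum H | u != w) [set phi u]| <= n * 1.
    by rewrite /n [#|H|]cardE; apply: card_bigcup_leq => u _; rewrite cards1.
  have le2 : #|\bigcup_(p <- enum {: H * H * H} | [&& p.1.1 != w, p.1.2 != w & p.2 != w])
    (if (phi p.2 \in S) && (phi p.2 \notin heavy)
     then color_nbrs col (col [set phi p.1.1; phi p.1.2]) S (phi p.2) else set0)|
     <= n * n * n * h.
    rewrite /n -!card_prod [in leqRHS]cardE; apply: card_bigcup_leq => p _.
    by case: ifP => [/andP[pS pU] | _]; [apply/ltnW/heavyP | rewrite cards0].
  apply: leq_trans (leq_of_leqif (leq_card_setU _ _)) _.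
  have := leq_of_leqif (leq_card_setU heavy (\bigcup_(u <- enum H | u != w) [set phi u])).
  move: le1 le2 card_heavy; rewrite expnS expnS expn1.
  move: #|_| #|_| #|_| #|_| => a b c d *; nia.
- exact: small.
have phi_inj : injective phi.
  move=> x y xy; apply/eqP/contraT => xNy; have [_ /negP[]] := phiP y.
  rewrite /avoid inE; apply/orP; left; rewrite inE; apply/orP; right.
  apply: (subsetP (subset_bigcup_seq _ (mem_enum H x) xNy)).
  by rewrite inE xy.
have no_repeat x y z w : x != w -> y != w -> z != w ->
    col [set phi x; phi y] <> col [set phi z; phi w].
  move=> xw yw zw E; have [wS /negP[]] := phiP w.
  rewrite /avoid inE; apply/orP; right.
  apply: (subsetP (@subset_bigcup_seq _ _ _ _ _ (x, y, z) _ _)) => /=;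
    rewrite ?mem_enum ?xw ?yw ?zw //.
  have [zS] := phiP z; rewrite !inE !negb_or => /andP[/andP[zU _] _].
  by rewrite zS zU inE wS /color_rel (inj_eq phi_inj) zw E eqxx.
exists phi => //; apply: Or32 => e e' /edgesP[x [y [xy ->]]] /edgesP[z [w [zw ->]]] /=.
rewrite !imsetU1 !imset_set1 => E; apply/eqP/contraT => ee'.
have zNw : z != w by apply: contraTneq zw => ->; rewrite adj_irrefl.
have xNy : x != y by apply: contraTneq xy => ->; rewrite adj_irrefl.
have : ~~ ([set z; w] \subset [set x; y]).
  apply: contra ee' => sub; rewrite eq_sym eqEcard sub !cards2 zNw xNy //.
case/subsetPn => t; rewrite !inE negb_or => /orP[] /eqP -> /andP[tx ty].
  by case: (@no_repeat x y w z); rewrite // 1?eq_sym // E setUC.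
by case: (@no_repeat x y z w); rewrite // 1?eq_sym.
Qed.

(** * The iteration and its exponents *)

Lemma expn_sum_lt n a b c : 1 < n -> a < c -> b < c -> n ^ a + n ^ b < n ^ c.+1.
Proof.
move=> n1 ac bc; rewrite expnS; apply: leq_trans (_ : 2 * n ^ c <= _).
  by rewrite mul2n -addnn -addSn leq_add ?ltn_exp2l // ltnW ?ltn_exp2l.
by rewrite leq_mul2r n1 orbT.
Qed.

Lemma exists_subset_card (T : finType) (S : {set T}) m :
  m <= #|S| -> exists2 A : {set T}, A \subset S & #|A| = m.
Proof.
move=> mS; exists [set x in take m (enum S)].
  by apply/subsetP => x; rewrite inE => /mem_take; rewrite mem_enum.
rewrite cardsE (card_uniqP _) ?take_uniq ?enum_uniq //.
by rewrite size_take -cardE; case: ltngtP mS => // ->.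
Qed.

Lemma size_sum_count (U w : seq nat) :
  uniq U -> {subset w <= U} -> size w = \sum_(c <- U) count_mem c w.
Proof.
move=> uU; elim: w => [|x w IH] wU; first by rewrite big1.
rewrite /= big_split /= -IH; last by move=> y yw; apply: wU; rewrite inE yw orbT.
suff -> : \sum_(c <- U) (x == c) = 1 by [].
transitivity (count_mem x U).
  by rewrite -sum1_count [RHS]big_mkcond; apply: eq_bigr => c _; rewrite eq_sym /=; case: (c == x).
by rewrite count_uniq_mem // wU // mem_head.
Qed.

(* [L] lists vertices [v] with a colour [c] such that all edges from [v] to later
   vertices of [L] and to [S] have colour [c]; [w] records the colours on which
   dependent random choice was applied. *)
Lemma canonical_copy (H : sgraph) N (col : edge_coloring N) D chi (f : H -> 'I_chi)
    (k : nat) (S : {set 'I_N}) (L : seq ('I_N * nat)) (w : seq nat) :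
  2 < #|H| -> 1 < D -> max_degree H <= D -> (forall x y, adj x y -> f x != f y) ->
  #|H| * chi.+1 <= size L + size w + k -> (#|H| ^ (16 * D)) ^ k <= #|S| ->
  uniq (map snd L) -> pairwise (fun p q => color_rel col p.2 p.1 q.1) L ->
  (forall p s, p \in L -> s \in S -> color_rel col p.2 p.1 s) ->
  {subset w <= map snd L} ->
  (forall c, nested (color_rel col c) #|H| D (count_mem c w) S) ->
  exists2 phi : H -> 'I_N, injective phi & canonically_colored col phi.
Proof.
move=> n3 D2 degD proper_f; set n := #|H| in n3 *.
have n0 : 0 < n by lia.
(* Pigeonhole: if [L'] has fewer than [n] entries and each of its colours occurs fewer than [chi]
   times in [w'], the two lengths add up to less than [n * chi.+1]. *)
have stop (A : {set 'I_N}) (L' : seq ('I_N * nat)) w' :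
    A != set0 -> uniq (map snd L') ->
    pairwise (fun p q => color_rel col p.2 p.1 q.1) L' ->
    {subset w' <= map snd L'} ->
    (forall c, nested (color_rel col c) n D (count_mem c w') A) ->
    n * chi.+1 <= size L' + size w' ->
    exists2 phi : H -> 'I_N, injective phi & canonically_colored col phi.
  move=> A0 uL pL wL nestA long; have [nL | Ln] := leqP n (size L').
    by apply: (lexicographic_copy (L := L')) => //; rewrite n0.
  have [/hasP[c _ chic] | /hasPn small] :=
      boolP (has (fun c => chi <= count_mem c w') (map snd L')).
    apply: (@monochromatic_copy H N col D (count_mem c w') c A f) => // x.
    exact: leq_trans (ltn_ord _) chic.
  have : size w' <= size L' * chi.
    rewrite (size_sum_count uL wL) -(size_map snd L') -sum1_size big_distrl /=.
    rewrite big_seq_cond [leqRHS]big_seq_cond; apply: leq_sum => c /andP[/small + _].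
    by rewrite mul1n -ltnNge => /ltnW.
  move: long; nia.
elim: k S L w => [|k IH] S L w steps cardS uniqU pairL LS wU nestS.
  apply: (stop S L w) => //; last by rewrite -[leqRHS]addn0.
  by rewrite -card_gt0; apply: leq_trans cardS.
(* Trimming to an exact power of [n] reduces the later estimates to comparisons of exponents. *)
have [S1 S1S cardS1] := exists_subset_card cardS.
set E := 16 * D * k.+1; have cardE1 : #|S1| = n ^ E by rewrite cardS1 -expnM.
have E6 : 32 <= E by rewrite /E; nia.
pose h := n ^ (E - 6).
have h0 : 0 < h by rewrite expn_gt0 n0.
have hk : (n ^ (16 * D)) ^ k <= h.
  by rewrite -expnM leq_exp2l /E; nia.
have [[v [c [vS cU hv]]] | light] := classic (exists v c,
    [/\ v \in S1, c \notin map snd L & h <= #|color_nbrs col c S1 v|]).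
  have sub : color_nbrs col c S1 v \subset S.
    by apply: subset_trans S1S; apply/subsetP => x; rewrite inE => /andP[].
  apply: (IH (color_nbrs col c S1 v) (rcons L (v, c)) w).
  - by rewrite size_rcons; move: steps; lia.
  - exact: leq_trans hk hv.
  - by rewrite map_rcons rcons_uniq cU.
  - rewrite pairwise_rcons pairL andbT; apply/allP => p pL /=.
    by apply: LS => //; apply: (subsetP S1S).
  - move=> p s; rewrite mem_rcons inE => /orP[/eqP-> | pL] sS.
      by move: sS; rewrite inE => /andP[].
    by apply: LS => //; apply: (subsetP sub).
  - by move=> x /wU; rewrite map_rcons mem_rcons inE => ->; rewrite orbT.
  - by move=> x; apply: nested_sub sub (nestS x).
have [[c cU hc] | few] := classic (exists2 c,
    c \in map snd L & h <= #|[set v in S1 | h <= #|color_nbrs col c S1 v|]|).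
  have [|A [AS1 cardA goodA]] := @dependent_random_choice _ (color_rel col c) S1 D n
    (2 * D) h ((n ^ (16 * D)) ^ k) (color_rel_sym col c) hc.
    (* The first summand has exponent [(2 * D + 1) * E - 16 * D], against [(2 * D + 1) * (E - 6)] on
       the right. As [D >= 2], [16 * D] exceeds [12 * D + 7], where the extra 1 absorbs the sum of
       two powers. *)
    rewrite cardE1 /h -!expnM -!expnD.
    have -> : (E - 6) * (2 * D).+1 = ((E - 6) * (2 * D).+1).-1.+1 by nia.
    by apply: expn_sum_lt; first lia; rewrite /E; nia.
  have AS := subset_trans AS1 S1S.
  apply: (IH A L (c :: w)) => //.
  - by rewrite /=; move: steps; lia.
  - by move=> p s pL sA; apply: LS => //; apply: (subsetP AS).
  - by move=> x; rewrite inE => /orP[/eqP->|/wU].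
  (* For the colour [c], the set [S1] enters the chain directly around [A]; for other colours [A] is
     merely a smaller innermost set. *)
  - move=> x /=; case: eqP => [<-|_]; last exact: nested_sub AS (nestS x).
    by rewrite add1n; exists S1; split=> //; apply: nested_sub S1S (nestS c).
have [nL | Ln] := leqP n (size L).
  by apply: (lexicographic_copy (L := L)) => //; rewrite n0.
apply: (@rainbow_copy H N col S1 (map snd L) h) => // [|v c vS cU|c cU|].
- by rewrite size_map ltnW.
- by rewrite ltnNge; apply/negP => hv; apply: light; exists v, c.
- by rewrite ltnNge; apply/negP => hc; apply: few; exists c.
(* The factor 3 is bounded by [n], so [n ^ 5 * h] must stay below [#|S1|]; this is why [h] is
   smaller by [n ^ 6]. *)
rewrite cardE1 /h; apply: leq_ltn_trans (_ : n ^ (1 + (1 + 3 + (E - 6))) < _).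
  by rewrite !expnD !expn1 !leq_mul.
by rewrite ltn_exp2l; lia.
Qed.

Lemma canonical_Ramsey_bound (H : sgraph) :
  2 <= max_degree H -> 3 <= chromatic_number H ->
  canonical_Ramsey H (#|H| ^ (32 * max_degree H * chromatic_number H * #|H|)).
Proof.
rewrite /chromatic_number; case: ex_minnP => chi /existsP[f /forallP proper_f] _ D2 chi3 col.
have n3 : 2 < #|H|.
  suff : max_degree H <= #|H|.-1 by lia.
  apply/bigmax_leqP => x _; rewrite -(cardC1 x).
  apply/subset_leq_card/subsetP => y; rewrite !inE => xy.
  by apply: contraTneq xy => ->; rewrite adj_irrefl.
(* Both lists start empty, so [#|H| * chi.+1] steps are provided; [chi.+1 <= 2 * chi] turns the 16
   into 32. *)
apply: (@canonical_copy H _ col (max_degree H) chi f (#|H| * chi.+1) setT [::] [::]) => //.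
- by move=> x y; apply/implyP/(forallP (proper_f x)).
- rewrite cardsT card_ord -expnM leq_exp2l; last lia.
  nia.
Qed.

(** [canonical_Ramsey] is a [Prop] quantifying over all colourings, so its minimum is obtained by
    excluded middle. *)
Lemma exists_least (P : nat -> Prop) n :
  P n -> exists2 m, m <= n & P m /\ forall k, P k -> m <= k.
Proof.
have [m] := ubnP n; elim: m n => // m IH n; rewrite ltnS => nm Pn.
have [[k kn Pk] | least] := classic (exists2 k, k < n & P k).
  have [|j jk Pj] := IH k _ Pk; first exact: leq_trans kn nm.
  by exists j => //; apply: leq_trans jk (ltnW kn).
exists n => //; split=> // k Pk; rewrite leqNgt; apply/negP => kn.
by apply: least; exists k.
Qed.

Theorem theorem2p4 :
  exists C : nat, forall (H : sgraph) (n Delta chi : nat),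
    #|H| = n -> max_degree H = Delta -> chromatic_number H = chi ->
    2 <= Delta -> 3 <= chi ->
    exists2 N : nat, is_ER H N & N <= n ^ (C * Delta * chi * n).
Proof.
exists 32 => H n Delta chi <- <- <- D2 chi3.
have [N le_N leastN] := exists_least (canonical_Ramsey_bound D2 chi3).
by exists N.
Qed.
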